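(* For each integer $r\ge 1$ there exist positive real constants $\alpha_r$ and $\beta_r$, depending only on $r$, such that for every integer $k$ with $r\le k-2$, \[ \alpha_r k^r\le \chi(K^2(2k+r,k))\le \beta_r k^r . \] That is, $\chi(K^2(2k+r,k))=\Theta(k^r)$ for each fixed $r$.
   Context: For integers $m\ge 2k$, the Kneser graph $K(m,k)$ is the graph whose vertices are the $k$-element subsets of a fixed $m$-element set, two vertices $A,B$ being adjacent if and only if $A\cap B=\emptyset$. The square $G^2$ of a simple graph $G$ has vertex set $V(G)$, and two distinct vertices are adjacent in $G^2$ if and only if their distance in $G$ is at most $2$. $K^2(m,k)$ denotes the square of $K(m,k)$, and $\chi$ denotes the chromatic number. *)

(* Defs.v *)
From mathcomp Require Import all_boot.

Set Implicit Arguments.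
Unset Strict Implicit.
Unset Printing Implicit Defensive.

(* A finite simple graph is a symmetric irreflexive relation on a finType. *)

Section Graph.
Variables (T : finType) (e : rel T).

Definition has_walk (n : nat) (x y : T) : bool :=
  [exists p : n.-tuple T, path e x p && (last x p == y)].

(* [None] stands for an infinite distance. Bounding the search by #|T| is
   harmless, see [gdist_leP]. *)
Definition gdist (x y : T) : option nat :=
  let d := find (fun n => has_walk n x y) (iota 0 #|T|) in
  if d < #|T| then Some d else None.

Definition gdist_le (n : nat) (x y : T) : bool :=
  if gdist x y is Some d then d <= n else false.

Definition square : rel T := fun x y => (x != y) && gdist_le 2 x y.

Definition colorable (n : nat) : bool :=
  [exists c : {ffun T -> 'I_n}, forall x, forall y, e x y ==> (c x != c y)].

(* A loopless graph is #|T|-colorable, so the minimum ranges over a nonempty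
   set. On a relation with a loop, the value is meaningless. *)
Definition chromatic_number : nat :=
  [arg min_(n < (ord_max : 'I_#|T|.+1) | colorable n) (n : nat)].

Lemma has_walkP n x y :
  reflect (exists p, [/\ size p = n, path e x p & last x p = y])
          (has_walk n x y).
Proof.
apply: (iffP existsP) => [[p /andP[ep /eqP lp]]|[p [sp ep lp]]].
  by exists p; rewrite size_tuple.
by exists (tcast sp (in_tuple p)); rewrite val_tcast /= ep lp eqxx.
Qed.

Lemma gdist_leP n x y :
  reflect (exists p, [/\ size p <= n, path e x p & last x p = y])
          (gdist_le n x y).
Proof.
rewrite /gdist_le /gdist; set a := fun n => has_walk n x y.
apply: (iffP idP) => [|[p [sp ep lp]]].
  case: ifP => // ltT len.
  have : has a (iota 0 #|T|) by rewrite has_find size_iota.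
  move/(nth_find 0); rewrite nth_iota // add0n.
  by case/has_walkP=> p [sp ep lp]; exists p; rewrite sp.
have [q [ltq leq_n eq lq]] :
    exists q, [/\ size q < #|T|, size q <= n, path e x q & last x q = y].
  move: lp; case: (shortenP ep) => q eq uq sub lq.
  exists q; split=> //; first by move/card_uniqP: uq => /= <-; apply: max_card.
  by apply: leq_trans sp; apply: uniq_leq_size => //; case/andP: uq.
have aq : a (size q) by apply/has_walkP; exists q.
have led : find a (iota 0 #|T|) <= size q.
  rewrite leqNgt; apply/negP => /(before_find 0).
  by rewrite nth_iota // add0n aq.
by rewrite (leq_ltn_trans led ltq) (leq_trans led).
Qed.

Lemma leq_chromatic_number n :
  irreflexive e -> (chromatic_number <= n) = colorable n.
Proof.
move=> irr.
have colS m m' : m <= m' -> colorable m -> colorable m'.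
  move=> le /existsP[c /forallP cP]; apply/existsP.
  exists [ffun x => widen_ord le (c x)]; apply/forallP => x; apply/forallP => y.
  by apply/implyP => /(implyP (forallP (cP x) y)); rewrite !ffunE.
have colT : colorable (ord_max : 'I_#|T|.+1).
  apply/existsP; exists [ffun x => enum_rank x].
  apply/forallP => x; apply/forallP => y; apply/implyP => exy; rewrite !ffunE.
  by apply: contraTneq exy => /enum_rank_inj->; rewrite irr.
rewrite /chromatic_number; case: arg_minnP => // i ci imin.
apply/idP/idP => [le|cn]; first exact: colS ci.
have [ltn|gen] := ltnP n #|T|.+1; first exact: (imin (Ordinal ltn)).
by apply: ltnW; apply: leq_trans gen.
Qed.

End Graph.

Definition ksubset (m k : nat) : finType := {A : {set 'I_m} | #|A| == k}.

Definition kneser (m k : nat) : rel (ksubset m k) :=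
  fun A B => val A :&: val B == set0.

Lemma kneser_sym m k : symmetric (@kneser m k).
Proof. by move=> A B; rewrite /kneser setIC. Qed.

Lemma kneser_irr m k : 0 < k -> irreflexive (@kneser m k).
Proof.
move=> k_gt0 A; apply/negbTE.
by rewrite /kneser setIid -card_gt0 (eqP (valP A)).
Qed.

Definition kneser_square (m k : nat) : rel (ksubset m k) :=
  square (@kneser m k).

(* Main.v *)
Require Import Defs.
From mathcomp Require Import all_boot all_order all_algebra.
From mathcomp Require Import finfield zify.
From mathcomp Require Import reals.
Import Order.TTheory GRing.Theory Num.Theory.
Local Open Scope ring_scope.

(** Lower bound: the neighbours of a vertex [C] of [K(2k+r,k)] are the
    [k]-subsets of the complement of [C]; they are pairwise at distance at most
    2, so they form a clique of size ['C(k+r,k) >= k^r / r!] in the square.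

    Upper bound: two vertices adjacent in the square are either disjoint or
    share at least [k-r] points.  A product of two colourings separates them:
    the standard [(r+2)]-colouring of the Kneser graph deals with disjoint sets,
    and the Graham-Sloane colouring deals with the others.  The latter embeds
    the ground set in a finite field with [q <= 2(2k+r)] elements and colours
    [A] by the [r] coefficients of [\prod_(a in A) ('X - a)] just below the
    leading one.  If [A] and [B] get the same colour, the difference of their
    polynomials has degree less than [k-r] and vanishes on [A :&: B]. *)

Lemma widen_ord_inj (m n : nat) (le_mn : (m <= n)%N) :
  injective (widen_ord le_mn).
Proof. by move=> i j /(congr1 val) /= /val_inj. Qed.

Section Colourings.
Variables (T : finType) (e : rel T).

Lemma square_irr : irreflexive (square e).
Proof. by move=> x; rewrite /square eqxx. Qed.

Lemma colorable_fin (C : finType) (c : T -> C) (n : nat) :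
  (forall x y, e x y -> c x != c y) -> (#|C| <= n)%N -> colorable e n.
Proof.
move=> cP leCn; apply/existsP.
exists [ffun x => widen_ord leCn (enum_rank (c x))].
apply/forallP => x; apply/forallP => y; apply/implyP => /cP.
by apply: contraNN; rewrite !ffunE => /eqP/widen_ord_inj/enum_rank_inj ->.
Qed.

Lemma colorable_union (e1 e2 : rel T) (n1 n2 : nat) :
  (forall x y, e x y -> e1 x y || e2 x y) ->
  colorable e1 n1 -> colorable e2 n2 -> colorable e (n1 * n2)%N.
Proof.
move=> sub /existsP[c1 /forallP c1P] /existsP[c2 /forallP c2P].
apply: (@colorable_fin ('I_n1 * 'I_n2)%type (fun x => (c1 x, c2 x))); last first.
  by rewrite card_prod !card_ord.
move=> x y /sub; rewrite xpair_eqE negb_and => /orP[exy|exy]; apply/orP.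
  by left; apply: (implyP (forallP (c1P x) y)).
by right; apply: (implyP (forallP (c2P x) y)).
Qed.

Lemma leq_clique_colorable (K : {set T}) (n : nat) :
  {in K &, forall x y, x != y -> e x y} -> colorable e n -> (#|K| <= n)%N.
Proof.
move=> cliqueK /existsP[c /forallP cP].
have injc : {in K &, injective c}.
  move=> x y xK yK cxy; apply/eqP; apply: contraT => nxy.
  by have := implyP (forallP (cP x) y) (cliqueK _ _ xK yK nxy); rewrite cxy eqxx.
by rewrite -(card_in_imset injc) (leq_trans (max_card _)) ?card_ord.
Qed.

End Colourings.

(** Any two neighbours of [z] are joined by a walk of length 2 through [z]. *)
Lemma leq_degree_colorable_square (T : finType) (e : rel T) (z : T) (n : nat) :
  symmetric e -> colorable (square e) n -> (#|[set x | e z x]| <= n)%N.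
Proof.
move=> esym; apply: leq_clique_colorable => x y; rewrite !inE => zx zy nxy.
rewrite /square nxy; apply/gdist_leP; exists [:: z; y].
by rewrite /= esym zx zy.
Qed.

Lemma card_kneser_neighbours (m k : nat) (C : ksubset m k) :
  #|[set A | kneser C A]| = 'C(m - k, k).
Proof.
have <- : #|~: val C| = (m - k)%N.
  by rewrite cardsCs setCK card_ord (eqP (valP C)).
rewrite -cards_draws -(card_imset _ val_inj); apply: eq_card => A.
rewrite !inE; apply/imsetP/andP => [[B]|[sAC kA]].
  rewrite inE /kneser setI_eq0 => CB ->.
  by rewrite -disjoints_subset disjoint_sym CB (valP B).
exists (Sub A kA); rewrite ?SubK //.
by rewrite inE /kneser SubK setI_eq0 disjoint_sym disjoints_subset.
Qed.

Lemma leq_bin_chromatic_kneser_square (r k : nat) :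
  ('C(k + r, r) <= chromatic_number (@kneser_square (2 * k + r) k))%N.
Proof.
have /card_gt0P[A] : (0 < #|[set A : {set 'I_(2 * k + r)} | #|A| == k]|)%N.
  by rewrite card_draws card_ord bin_gt0; lia.
rewrite inE => kA.
have -> : 'C(k + r, r) = #|[set B | kneser (Sub A kA : ksubset _ _) B]|.
  by rewrite card_kneser_neighbours -bin_sub; [congr 'C(_, _)|]; lia.
apply: leq_degree_colorable_square; first exact: kneser_sym.
by rewrite -leq_chromatic_number //; apply: square_irr.
Qed.

(** [C] avoids [A :|: B], whose size is given by inclusion-exclusion. Applied below with [C] a
    common neighbour, then with [C] a set of [r+1] points. *)
Lemma leq_card_common_disjoint (T : finType) (A B C : {set T}) :
  A :&: C = set0 -> B :&: C = set0 ->
  (#|A| + #|B| + #|C| <= #|T| + #|A :&: B|)%N.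
Proof.
move=> AC0 BC0; have := max_card (mem ((A :|: B) :|: C)).
by rewrite cardsU setIUl AC0 BC0 setU0 cards0 -(cardsUI A B); lia.
Qed.

Lemma kneser_squareP (r k : nat) (A B : ksubset (2 * k + r) k) :
  kneser_square A B ->
  kneser A B || (A != B) && (k <= r + #|val A :&: val B|)%N.
Proof.
case/andP => nAB /gdist_leP[[|C [|D [|? ?]]] [] //= _].
- by move=> _ eAB; rewrite eAB eqxx in nAB.
- by rewrite andbT => dAC <-; rewrite dAC.
rewrite andbT => /andP[dAC dCB] eDB; rewrite {D}eDB in dCB.
rewrite nAB; apply/orP; right.
rewrite kneser_sym in dCB.
(* The bound reads [3k <= 2k + r + #|A :&: B|]. *)
have := leq_card_common_disjoint _ _ _ _ (eqP dAC) (eqP dCB).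
rewrite card_ord (eqP (valP A)) (eqP (valP B)) (eqP (valP C)) => le_k.
(* [//=] left [sval] in the goal, which [lia] does not identify with [val]. *)
suff : (k <= r + #|val A :&: val B|)%N by [].
by move: le_k; clear; lia.
Qed.

(** The colour of [A] is one of the first [r+1] points lying in [A], or [None] if there is none. Two
    disjoint sets coloured [None] would require [2k + r + 1] points. *)
Lemma colorable_kneser (r k : nat) :
  (0 < k)%N -> colorable (@kneser (2 * k + r) k) r.+2.
Proof.
move=> k_gt0; have le_rm : (r.+1 <= 2 * k + r)%N by lia.
pose c (A : ksubset (2 * k + r) k) := [pick i | widen_ord le_rm i \in val A].
apply: (@colorable_fin _ _ _ c); last by rewrite card_option card_ord.
move=> A B; rewrite /kneser setI_eq0 => dAB; rewrite /c.
case: pickP => [i iA|nA]; case: pickP => [j jB|nB] //.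
  apply: contraTneq dAB => -[ij]; apply/pred0Pn; exists (widen_ord le_rm i).
  by rewrite /= iA ij jB.
pose L := [set widen_ord le_rm i | i in 'I_r.+1].
have cL : #|L| = r.+1.
  by rewrite card_imset ?card_ord // => i j /widen_ord_inj.
have dL (X : ksubset (2 * k + r) k) :
    (fun i => widen_ord le_rm i \in val X) =1 xpred0 -> val X :&: L = set0.
  move=> nX; apply/eqP; rewrite setI_eq0 disjoint_sym disjoint_subset.
  by apply/subsetP => _ /imsetP[i _ ->]; rewrite inE nX.
have := leq_card_common_disjoint _ _ _ _ (dL A nA) (dL B nB).
move: dAB; rewrite -setI_eq0 => /eqP->; rewrite cards0 cL card_ord.
by rewrite (eqP (valP A)) (eqP (valP B)); clear; lia.
Qed.

Lemma colorable_large_meet (F : finFieldType) (m r k : nat) :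
  (m <= #|F|)%N ->
  colorable (fun A B : ksubset m k =>
    (A != B) && (k <= r + #|val A :&: val B|)%N) (#|F| ^ r)%N.
Proof.
move=> le_mF; pose phi (i : 'I_m) : F := enum_val (widen_ord le_mF i).
have phi_inj : injective phi by move=> i j /enum_val_inj/widen_ord_inj.
pose P (A : ksubset m k) : {poly F} :=
  \prod_(i <- enum (val A)) ('X - (phi i)%:P).
have sP A : size (P A) = k.+1.
  by rewrite /P size_prod_XsubC -cardE (eqP (valP A)).
have rootPE A i : root (P A) (phi i) = (i \in val A).
  rewrite /P -(big_map phi predT (fun a => 'X - a%:P)) /=.
  by rewrite root_prod_XsubC mem_map // mem_enum.
have monP A : P A \is monic by apply: monic_prod => i _; apply: monicXsubC.
pose c A := [ffun j : 'I_r => (P A)`_(k - r + j)].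
apply: (@colorable_fin _ _ _ c); last by rewrite card_ffun card_ord.
move=> A B /andP[nAB meet]; apply: contraNneq nAB => /ffunP eqc.
(* Coefficients from [k-r] to [k-1] agree by the colouring, the [k]-th because both polynomials are
   monic, and higher ones vanish. *)
have sPAB : (size (P A - P B)%R <= k - r)%N.
  apply/leq_sizeP => i le_i; rewrite coefB; apply/eqP; rewrite subr_eq0.
  have [lt_ik|] := ltnP i k.
    have lt_j : (i - (k - r) < r)%N by lia.
    by have := eqc (Ordinal lt_j); rewrite !ffunE /= subnKC // => ->.
  rewrite leq_eqVlt => /predU1P[<-|lt_ki]; last by rewrite !nth_default ?sP.
  have lc X : (P X)`_k = 1 by rewrite -(monicP (monP X)) lead_coefE sP.
  by rewrite !lc.
have PAB : P A = P B.
  apply/eqP; rewrite -subr_eq0; apply: contraT => nz.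
  have := @max_poly_roots _ _ (map phi (enum (val A :&: val B))) nz.
  rewrite map_inj_uniq // enum_uniq size_map -cardE => /(_ _ isT) lt_size.
  suff : (#|val A :&: val B| < k - r)%N by lia.
  apply: leq_trans sPAB; apply: lt_size; apply/allP => _ /mapP[i + ->].
  rewrite mem_enum inE -!rootPE => /andP[/eqP rA /eqP rB].
  by rewrite rootE hornerD hornerN rA rB subrr.
(* A set is recovered from the roots of its polynomial. *)
by apply/eqP/val_inj/setP => i; rewrite -!rootPE PAB.
Qed.

(** The least power of 2 that is at least [m] is less than [2m]. *)
Lemma ex_finField_card (m : nat) :
  (1 < m)%N -> exists F : finFieldType, (m <= #|F| <= 2 * m)%N.
Proof.
move=> m_gt1; have /andP[lb ub] := up_log_bounds (isT : 1 < 2)%N m_gt1.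
have s_gt0 : (0 < up_log 2 m)%N by rewrite up_log_gt0 m_gt1.
have [F _ cF] := pPrimePowerField (isT : prime 2) s_gt0.
exists F; rewrite cF ub /= -(prednK s_gt0) expnS leq_mul2l /=.
exact: ltnW.
Qed.

Lemma chromatic_kneser_square_leq (r k : nat) :
  (0 < r)%N -> (r <= k)%N ->
  (chromatic_number (@kneser_square (2 * k + r) k) <= r.+2 * (6 * k) ^ r)%N.
Proof.
move=> r_gt0 le_rk; have m_gt1 : (1 < 2 * k + r)%N by lia.
have [F /andP[le_mF le_Fm]] := ex_finField_card _ m_gt1.
apply: (@leq_trans (r.+2 * #|F| ^ r)%N); last first.
  (* Since [r <= k], [2(2k+r) <= 6k]. *)
  by rewrite leq_mul2l leq_exp2r //; apply: leq_trans le_Fm _; lia.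
rewrite leq_chromatic_number; last exact: square_irr.
have colK := colorable_kneser r k (leq_trans r_gt0 le_rk).
have colL := colorable_large_meet F _ r k le_mF.
by apply: colorable_union colK colL => A B; apply: kneser_squareP.
Qed.

(** Each of the [r] factors [k+1, ..., k+r] is at least [k]. *)
Lemma leq_exp_ffact (k r : nat) : (k ^ r <= (k + r) ^_ r)%N.
Proof.
elim: r => // r IHr; rewrite addnS ffactSS expnS leq_mul //.
by rewrite -addnS leq_addr.
Qed.

Theorem mainTheorem6 (R : realType) (r : nat) (hr : (1 <= r)%N) :
  exists alpha beta : R,
    [/\ 0 < alpha, 0 < beta &
      forall k : nat, (r + 2 <= k)%N ->
        alpha * k%:R ^+ r
          <= (chromatic_number (@kneser_square (2 * k + r) k))%:R
          <= beta * k%:R ^+ r].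
Proof.
(* [alpha] comes from ['C(k+r,r) >= k^r / r!], [beta] from the [(r+2)(6k)^r] colours of the product
   colouring. *)
exists (r`!%:R^-1), (r.+2 * 6 ^ r)%N%:R; split.
- by rewrite invr_gt0 ltr0n fact_gt0.
- by rewrite ltr0n muln_gt0 expn_gt0.
move=> k le_rk; rewrite -natrX; apply/andP; split.
  rewrite ler_pdivrMl ?ltr0n ?fact_gt0 // -natrM ler_nat.
  apply: leq_trans (leq_exp_ffact k r) _.
  by rewrite -bin_ffact mulnC leq_mul2l leq_bin_chromatic_kneser_square orbT.
rewrite -natrM ler_nat -mulnA -expnMn.
by apply: chromatic_kneser_square_leq => //; lia.
Qed.
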